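(* Let $f\in l^1(\mathbb{Z})$ and $n\in\mathbb{Z}$. Then the set $$E_{f,n}:=\{r\in\mathbb{Z}^+:\ \mathcal{M}f(n)=\mathcal{A}_rf(n)\}$$ is non-empty (so that $\mathcal{F}f(n):=\inf E_{f,n}$ is well defined). Moreover, if $f$ is not identically zero, then $E_{f,n}$ is finite.
   Context: $\mathbb{Z}^+$ denotes the set of non-negative integers (including $0$). $l^1(\mathbb{Z})$ is the space of absolutely summable (real- or complex-valued) functions on $\mathbb{Z}$. For $f\in l^1(\mathbb{Z})$, $n\in\mathbb{Z}$ and $r\in\mathbb{Z}^+$, $$\mathcal{A}_rf(n):=\frac{1}{2r+1}\sum_{k=-r}^{r}|f(n+k)|,\qquad \mathcal{M}f(n):=\sup_{r\in\mathbb{Z}^+}\mathcal{A}_rf(n).$$ *)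

(* Defs.v *)
From mathcomp Require Import all_boot all_order all_algebra.
From mathcomp Require Import all_classical all_reals all_analysis.
From mathcomp Require Import complex.

Set Implicit Arguments.
Unset Strict Implicit.
Unset Printing Implicit Defensive.

Import Order.TTheory GRing.Theory Num.Theory.

Local Open Scope classical_set_scope.
Local Open Scope ring_scope.

(* The values of [f] lie in an arbitrary [V] whose norm is [R]-valued, so that
   the same definitions serve for the real scalars ([V := R]) and for the
   complex ones ([V := Rcomplex R], which is [R[i]] with the modulus as
   an [R]-valued norm). *)

Definition in_l1 (R : realType) (V : normedZmodType R) (f : int -> V) : Prop :=
  summable [set: int] (fun k => `|f k|%:E).

(* The index [i < 2 r + 1] stands for [k = i - r], which ranges over
   [-r, ..., r]. *)
Definition average (R : realType) (V : normedZmodType R) (f : int -> V)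
    (r : nat) (n : int) : R :=
  (r.*2.+1)%:R^-1 * \sum_(i < r.*2.+1) `|f (n + (i%:Z - r%:Z))|.

(* The supremum is taken in [\bar R], so it is the genuine one even when the
   averages are unbounded. *)
Definition maximal (R : realType) (V : normedZmodType R) (f : int -> V)
    (n : int) : \bar R :=
  ereal_sup (range (fun r : nat => (average f r n)%:E)).

Definition extremal_radii (R : realType) (V : normedZmodType R)
    (f : int -> V) (n : int) : set nat :=
  [set r | maximal f n = (average f r n)%:E].

(* Main.v *)
Require Import Defs.
From mathcomp Require Import all_boot all_order all_algebra.
From mathcomp Require Import all_classical all_reals all_analysis.
From mathcomp Require Import complex zify.

Set Implicit Arguments.
Unset Strict Implicit.
Unset Printing Implicit Defensive.

Import Order.TTheory GRing.Theory Num.Theory.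

Local Open Scope classical_set_scope.
Local Open Scope ring_scope.

(** Every average [average f r n] is at most [S / (2 r + 1)], where [S] is the
    l^1 norm of [f].  If [f] is non-zero at [k], then the average of radius
    [|k - n|] is positive, so only finitely many radii can do at least as
    well; the supremum is thus a maximum over a finite set of radii. *)

(** The hypothesis at [r0] itself forces [r0 < N]. A maximizer over the indices below [N] therefore
    dominates [u r0], and through it the whole tail. *)
Lemma eventually_lt_has_max (R : realDomainType) (u : nat -> R) (r0 N : nat) :
  (forall r, (N <= r)%N -> u r < u r0) -> exists m, forall r, u r <= u m.
Proof.
move=> tail.
have r0N : (r0 < N)%N by rewrite ltnNge; apply/negP => /tail; rewrite ltxx.
have [m _ max_m] := arg_maxP (fun i : 'I_N => u i) (isT : predT (Ordinal r0N)).
exists m => r; have [Nr|rN] := leqP N r; last exact: (max_m (Ordinal rN)).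
by rewrite (le_trans (ltW (tail _ Nr)))//; exact: (max_m (Ordinal r0N)).
Qed.

(** This is what makes [inf E] well defined: by well-ordering, the infimum is the least element. The
    empty set has none, as every natural number bounds it below. *)
Lemma nat_set_exists_infimum (A : set nat) :
  A !=set0 -> exists! m : nat, infimums A m.
Proof.
move=> [a Aa]; have exA : exists n, `[< A n >] by exists a; apply/asboolP.
have infm : infimums A (ex_minn exA).
  case: ex_minnP => m /asboolP Am min_m; split; last by move=> l; exact.
  by move=> r Ar; rewrite leEnat; apply/min_m/asboolP.
by exists (ex_minn exA); split=> // m'; exact: is_subset1_infimums.
Qed.

Section Averages.
Variables (R : realType) (V : normedZmodType R).
Implicit Types (f : int -> V) (n : int) (r : nat).

Lemma extremal_radiiP f n r :
  extremal_radii f n r <-> forall s, average f s n <= average f r n.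
Proof.
split=> [max_r s|max_r].
  by rewrite -lee_fin -max_r; apply: ereal_sup_ubound; exists s.
apply/le_anti/andP; split; last by apply: ereal_sup_ubound; exists r.
by apply: ge_ereal_sup => _ [s _ <-]; rewrite lee_fin.
Qed.

Lemma average_le f n : in_l1 f ->
  exists S : R, forall r, average f r n <= (r.*2.+1)%:R^-1 * S.
Proof.
rewrite /in_l1 summableE => /fineK f_fin.
(* [S] is the l^1 norm of [f]; the outer absolute value comes from the definition of [summable]. *)
exists (fine (\esum_(k in [set: int]) `| `|f k|%:E |)%E) => r.
rewrite /average ler_pM2l ?invr_gt0 ?ltr0n// -lee_fin f_fin.
apply: esum_ge.
pose h (i : 'I_(r.*2.+1)) : int := n + (i%:Z - r%:Z).
(* The window consists of distinct integers, so its sum is a finite partial sum of the l^1 norm. *)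
have h_inj : injective h by move=> i j; rewrite /h => hij; apply: ord_inj; lia.
exists [set` map h (enum 'I_(r.*2.+1))]; first by split; [exact: finite_seq|].
rewrite -fsbig_seq; last by rewrite (map_inj_uniq h_inj) enum_uniq.
rewrite big_map big_enum/= -sumEFin.
by under [leRHS]eq_bigr do rewrite normr_id.
Qed.

Lemma average_gt0 f n (k : int) : f k != 0 -> 0 < average f `|k - n|%N n.
Proof.
move=> fk0; set r := `|k - n|%N; rewrite mulr_gt0 ?invr_gt0 ?ltr0n//.
(* The position of [k] in the window is [k - n + r], which is [0] or [2 r]; the absolute value only
   casts it to [nat]. *)
have ltj : (`|(k - n + r%:Z)%R| < r.*2.+1)%N by lia.
rewrite (bigD1 (Ordinal ltj))//= ltr_pwDl ?sumr_ge0//.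
by rewrite normr_gt0 (_ : n + _ = k)//; lia.
Qed.

Lemma average_eventually_lt f n (c : R) : in_l1 f -> 0 < c ->
  exists N : nat, forall r, (N <= r)%N -> average f r n < c.
Proof.
move=> /(average_le n)[S leS] c0.
(* [S / (2 r + 1) < c] amounts to [S / c < 2 r + 1]; the absolute value provides the non-negative
   argument that [archi_boundP] asks for. *)
exists (Num.bound `|S / c|) => r Nr; apply: le_lt_trans (leS r) _.
rewrite ltr_pdivrMl ?ltr0n// -ltr_pdivrMr//.
rewrite (le_lt_trans (ler_norm _))// (lt_le_trans (archi_boundP _))//.
by rewrite ler_nat (leq_trans Nr)//; lia.
Qed.

Lemma extremal_radii_neq0_finite f n : in_l1 f ->
  [/\ extremal_radii f n !=set0,
      exists! m : nat, infimums (extremal_radii f n) m &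
      (~ (forall k : int, f k = 0) -> finite_set (extremal_radii f n))].
Proof.
move=> fl1.
suff [E0 Efin] : extremal_radii f n !=set0 /\
    (~ (forall k : int, f k = 0) -> finite_set (extremal_radii f n)).
  by split=> //; exact: nat_set_exists_infimum.
(* For [f = 0] all averages vanish, so every radius is extremal. *)
have [f0|/existsNP[k /eqP fk0]] := pselect (forall k : int, f k = 0).
  have avg0 r : average f r n = 0.
    by rewrite /average big1 ?mulr0// => i _; rewrite f0 normr0.
  split; last by move=> /(_ f0).
  by exists 0%N; apply/extremal_radiiP => s; rewrite !avg0.
have [N tail] := average_eventually_lt n fl1 (average_gt0 n fk0).
split=> [|_].
  by have [m max_m] := eventually_lt_has_max tail; exists m; apply/extremal_radiiP.
(* A radius [r >= N] has an average below that of radius [|k - n|], so it is not extremal. *)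
apply: (sub_finite_set _ (finite_II N)) => r /extremal_radiiP max_r /=.
by rewrite ltnNge; apply/negP => /tail; rewrite ltNge max_r.
Qed.

End Averages.

Theorem mainTheorem7 (R : realType) :
  (forall (f : int -> R) (n : int), in_l1 f ->
     [/\ extremal_radii f n !=set0,
         exists! m : nat, infimums (extremal_radii f n) m &
         (~ (forall k : int, f k = 0) -> finite_set (extremal_radii f n))]) /\
  (forall (f : int -> Rcomplex R) (n : int), in_l1 f ->
     [/\ extremal_radii f n !=set0,
         exists! m : nat, infimums (extremal_radii f n) m &
         (~ (forall k : int, f k = 0) -> finite_set (extremal_radii f n))]).
Proof.
by split=> f n; exact: extremal_radii_neq0_finite.
Qed.
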